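(* Let $D\subset\mathbb{P}^{k+1}$ be a smooth rational curve of degree $d\ge 2k$, and assume that $D$ is contained in a rational normal surface $S\subset\mathbb{P}^{k+1}$ and is unisecant for the fibers of $S$. Let $P_1,\ldots,P_{k-1}\in\mathbb{P}^{k+1}\setminus S$ be points such that, by projecting $D$ into $\mathbb{P}^2$ from them, the projection is generically $1:1$ onto its image $C$. Then the splitting type of $C$ is $(k',d-k')$ with $k'\le k$.
   Context: The ground field $K$ is algebraically closed of characteristic $0$. Splitting type: let $C\subset\mathbb{P}^2$ be a rational curve of degree $d$, the image of a morphism $f=(f_0,f_1,f_2):\mathbb{P}^1\to\mathbb{P}^2$, $f_i\in R_d$ with $R=K[s,t]$, generically injective and generically smooth over its image. The splitting type of $C$ is the pair $(a,d-a)$, $2a\le d$, such that the minimal graded free resolution of the ideal $J=(f_0,f_1,f_2)\subset R$ is $0\to R(-a-d)\oplus R(a-2d)\to R(-d)^{\oplus 3}\to J\to 0$; equivalently, $f^*(\Omega_{\mathbb{P}^2}(1))\cong\mathcal{O}_{\mathbb{P}^1}(-a)\oplus\mathcal{O}_{\mathbb{P}^1}(-d+a)$. A rational normal surface (rational normal scroll) $S\subset\mathbb{P}^{k+1}$ is a surface of degree $k$ which is the union of the lines (the fibers) joining corresponding points of two rational normal curves of degrees $h$ and $k-h$, $0\le h\le k-h$, both parameterized by the same $\mathbb{P}^1$ and lying in complementary linear subspaces $\mathbb{P}^h$, $\mathbb{P}^{k-h}$ of $\mathbb{P}^{k+1}$ (a cone over a rational normal curve if $h=0$). A curve on $S$ is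 unisecant for the fibers if it meets the fibers in one point (intersection number $1$ with a fiber). Projection from $P_1,\ldots,P_{k-1}$ to $\mathbb{P}^2$ means linear projection with center the $(k-2)$-dimensional linear span of these points.
   Formalization: The formal theorem also assumes that the span of P_1,…,P_{k-1} does not meet D, so that C has degree d; with only P_i outside S the span may meet D when k≥3, and then deg C<d and the pair (k',d-k') is impossible. *)

(* Defs.v *)
From mathcomp Require Import all_boot all_algebra.
From mathcomp.multinomials Require Import mpoly.

Set Implicit Arguments.
Unset Strict Implicit.
Unset Printing Implicit Defensive.

Import GRing.Theory.
Local Open Scope ring_scope.

(* Points of P^n are nonzero row vectors of length n+1 up to proportionality;  *)
(* two points u, v coincide when they span the same line, i.e. (u == v)%MS,    *)
(* and a linear subspace is the row space of a matrix.  R = K[s,t] is          *)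
(* {mpoly K[2]}, and a map P^1 -> P^n is a row of n+1 binary forms.            *)

Definition eval_at (K : fieldType) (n : nat) (g : 'rV[{mpoly K[2]}]_n)
    (x : 'rV[K]_2) : 'rV[K]_n :=
  map_mx (meval (x 0)) g.

Definition const_form (K : fieldType) (m n : nat) (A : 'M[K]_(m, n)) :
    'M[{mpoly K[2]}]_(m, n) :=
  map_mx (@mpolyC 2 K) A.

(* g is a morphism P^1 -> P^(n-1) given by forms of degree d without common    *)
(* zeros.                                                                      *)
Definition morphism_of_degree (K : fieldType) (n d : nat)
    (g : 'rV[{mpoly K[2]}]_n) : Prop :=
  (forall j, g 0 j \is d.-homog) /\
  (forall x : 'rV[K]_2, x != 0 -> eval_at g x != 0).

(* jacobian g x is the matrix of partial derivatives of the affine cone map.   *)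
(* By Euler's formula, in characteristic 0 (and d > 0) it has rank 2 exactly   *)
(* when the differential of P^1 -> P^(n-1) at x is injective.                  *)
Definition jacobian (K : fieldType) (n : nat) (g : 'rV[{mpoly K[2]}]_n)
    (x : 'rV[K]_2) : 'M[K]_(2, n) :=
  \matrix_(i, j) ((g 0 j)^`M(i)).@[x 0].

(* The image of g is a smooth rational curve of degree d, and g identifies P^1 *)
(* with it: g is an injective immersion, that is, a closed embedding.          *)
Definition smooth_rational_curve (K : fieldType) (n d : nat)
    (g : 'rV[{mpoly K[2]}]_n) : Prop :=
  [/\ morphism_of_degree d g,
      (forall x y : 'rV[K]_2, x != 0 -> y != 0 ->
         (eval_at g x == eval_at g y)%MS -> (x == y)%MS)
    & (forall x : 'rV[K]_2, x != 0 -> row_free (jacobian g x))].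

(* g is injective away from finitely many points of P^1. *)
Definition generically_injective (K : fieldType) (n : nat)
    (g : 'rV[{mpoly K[2]}]_n) : Prop :=
  exists E : seq 'rV[K]_2, forall x y : 'rV[K]_2, x != 0 -> y != 0 ->
    ~~ has (fun e => (x == e)%MS) E ->
    (eval_at g x == eval_at g y)%MS -> (x == y)%MS.

Definition veronese (K : fieldType) (h : nat) (p : 'rV[K]_2) : 'rV[K]_h.+1 :=
  \row_(i < h.+1) (p 0 0 ^+ (h - i) * p 0 1 ^+ i).

(* p |-> veronese h p *m A, with row_free A, is a parameterized rational       *)
(* normal curve of degree h in the P^h spanned by the rows of A.               *)
Definition scroll_data (K : fieldType) (h l n : nat)
    (A : 'M[K]_(h.+1, n)) (B : 'M[K]_(l.+1, n)) : Prop :=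
  [/\ row_free A, row_free B, (A :&: B)%MS = 0 & row_full (A + B)%MS].

(* The line joining the points with the same parameter p. *)
Definition fiber (K : fieldType) (h l n : nat)
    (A : 'M[K]_(h.+1, n)) (B : 'M[K]_(l.+1, n)) (p : 'rV[K]_2) :
    'M[K]_(1 + 1, n) :=
  col_mx (veronese h p *m A) (veronese l p *m B).

Definition on_scroll (K : fieldType) (h l n : nat)
    (A : 'M[K]_(h.+1, n)) (B : 'M[K]_(l.+1, n)) (y : 'rV[K]_n) : Prop :=
  exists2 p : 'rV[K]_2, p != 0 & (y <= fiber A B p)%MS.

(* For h <= l: the vertex of the cone when h = 0, the empty subspace when      *)
(* h > 0.                                                                      *)
Definition vertex (K : fieldType) (h n : nat) (A : 'M[K]_(h.+1, n)) :
    'M[K]_(h.+1, n) :=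
  if h == 0%N then A else 0.

Definition divides (K : fieldType) (p q : {mpoly K[2]}) : Prop :=
  exists r, q = p * r.

(* The scheme-theoretic intersection of the curve embedded by g with the       *)
(* linear subspace L has length e: it is cut out on P^1 by the forms l(g), for *)
(* l a linear form vanishing on L, and so it is the zero scheme of their       *)
(* greatest common divisor q.                                                  *)
Definition intersection_length (K : fieldType) (m n : nat)
    (g : 'rV[{mpoly K[2]}]_n) (L : 'M[K]_(m, n)) (e : nat) : Prop :=
  exists q : {mpoly K[2]},
    [/\ q != 0, q \is e.-homog,
        (forall l : 'cV[K]_n, L *m l = 0 ->
           divides q ((g *m const_form l) 0 0))
      & (forall q' : {mpoly K[2]},
           (forall l : 'cV[K]_n, L *m l = 0 ->
              divides q' ((g *m const_form l) 0 0)) ->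
           divides q' q)].

(* The curve has intersection number 1 with each fiber.  If h > 0 the vertex   *)
(* is empty, so that e = 0 and the fiber meets the curve in a scheme of length *)
(* 1.  If h = 0 the number is taken on the blow-up of the cone at its vertex,  *)
(* i.e. for the proper transforms; this discards the intersection at the       *)
(* vertex, where all the fibers meet.                                          *)
Definition unisecant (K : fieldType) (h l n : nat)
    (A : 'M[K]_(h.+1, n)) (B : 'M[K]_(l.+1, n))
    (g : 'rV[{mpoly K[2]}]_n) : Prop :=
  forall p : 'rV[K]_2, p != 0 ->
    exists e : nat,
      intersection_length g (vertex A) e /\
      intersection_length g (fiber A B p) e.+1.

(* The ideal J = (f_0, f_1, f_2), generated by forms of degree d, has minimal  *)
(* graded free resolution                                                      *)
(*   0 -> R(-a-d) (+) R(a-2d) -> R(-d)^3 -> J -> 0,                            *)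
(* with M the matrix of the first map acting on row vectors: its rows are      *)
(* syzygies with entries of degrees a and d - a, and minimality says that the  *)
(* entries of M lie in the ideal (s, t).                                       *)
Definition splitting_type (K : fieldType) (d : nat)
    (f : 'rV[{mpoly K[2]}]_3) (a : nat) : Prop :=
  (2 * a <= d)%N /\
  exists M : 'M[{mpoly K[2]}]_(2, 3),
    [/\ (forall j, M 0 j \is (a).-homog) /\
          (forall j, M 1 j \is (d - a).-homog),
        (forall i j, (M i j)@_0%MM = 0),
        (forall v : 'rV[{mpoly K[2]}]_3,
           v *m f^T = 0 <-> exists c : 'rV[{mpoly K[2]}]_2, v = c *m M)
      & (forall c : 'rV[{mpoly K[2]}]_2, c *m M = 0 -> c = 0)].

(* Main.v *)
Require Import Defs.
From mathcomp Require Import all_boot all_algebra.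
From mathcomp.multinomials Require Import mpoly.
From mathcomp Require Import ring zify.
From Stdlib Require Import Classical.

(** In coordinates adapted to the two rational normal curves, a curve on the
scroll is g = al v_h(s) A + be v_l(s) B, where l = k - h, v_h and v_l are the
Veronese forms, s is a pair of forms of degree m without common zeros, and al
and be are forms ([scroll_curve_factorization]). Here m is the number of times
the curve meets a fiber, so m <= 1 for a unisecant curve ([unisecant_degree]).

Projecting by T, put u = v_h(s) A T and w = v_l(s) B T. The plane curve is
f = al u + be w: the point f(x) moves on the line joining u(x) and w(x), the
projection of a fiber. The equation of this moving line is the cross product
u x w, a syzygy of f of degree (h + l) m <= k. It is not zero: otherwise f,
which has degree d > k and no common zeros, would be parallel to u and w, which
have degree at most k ([parallel_small]).

It remains to see that three forms of degree d without common zeros and with a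
nonzero syzygy of degree k, 2 k <= d, have a splitting type (a, d - a) with
a <= k ([syzygy_resolution]). Let M be a syzygy of least degree a and N one of
least degree b among those that are not multiples of M. They are independent at
every point of the projective line, since a combination vanishing at a point
could be divided by its equation; hence they span all syzygies, by induction on
the degree, and M x N is a constant multiple of f, which gives a + b = d.
The resolution is minimal because a > 0: a constant syzygy would put the curve
in a line, and in characteristic 0 no map of degree d > 1 from the projective
line to itself is generically injective ([not_in_line]).

Unique factorization of forms is replaced throughout by two facts: over an
algebraically closed field a form of positive degree has a zero, and it is
divisible by the equation of each of its zeros. *)

Import GRing.Theory.
Local Open Scope ring_scope.

Set Implicit Arguments.
Unset Strict Implicit.

(** * Binary forms *)

Section Forms.
Variable K : fieldType.
Implicit Types (q r : {mpoly K[2]}) (p : {poly K}) (x y : 'rV[K]_2) (n : nat).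

(** The affine chart where the first coordinate is 1. *)
Definition dehom q : {poly K} :=
  mmap (@polyC K) (fun i : 'I_2 => if i == 0 then 1 else 'X) q.

Definition hom n p : {mpoly K[2]} :=
  \sum_(i < n.+1) p`_i *: ('X_0 ^+ (n - i) * 'X_1 ^+ i).

Definition linear_form x : {mpoly K[2]} := x 0 1 *: 'X_0 - x 0 0 *: 'X_1.

Lemma dehomM q r : dehom (q * r) = dehom q * dehom r.
Proof. by rewrite /dehom rmorphM. Qed.

Lemma dehomX (m : 'X_{1..2}) : dehom 'X_[m] = 'X^(m 1%R).
Proof.
rewrite /dehom mmapX /mmap1 big_ord_recl big_ord1 /= expr1n mul1r.
by congr (_ ^+ m _); apply: val_inj.
Qed.

Lemma mdeg2 (m : 'X_{1..2}) : mdeg m = (m 0%R + m 1%R)%N.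
Proof.
rewrite mdegE big_ord_recl big_ord1; congr (m _ + m _)%N; exact: val_inj.
Qed.

Lemma mpolyX2 (m : 'X_{1..2}) :
  'X_[m] = 'X_0 ^+ m 0%R * 'X_1 ^+ m 1%R :> {mpoly K[2]}.
Proof.
rewrite mpolyXE_id big_ord_recl big_ord1.
by congr ('X_ _ ^+ m _ * 'X_ _ ^+ m _); apply: val_inj.
Qed.

Lemma homog_X (i : 'I_2) : ('X_i : {mpoly K[2]}) \is 1.-homog.
Proof. by rewrite dhomogX /= mdeg1. Qed.

Lemma homog_expX n (i : 'I_2) : ('X_i ^+ n : {mpoly K[2]}) \is n.-homog.
Proof. by have := dhomogMn n (homog_X i); rewrite mul1n. Qed.

Lemma hom_homog n p : hom n p \is n.-homog.
Proof.
apply: rpred_sum => i _; apply: rpredZ.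
have := dhomogM (homog_expX (n - i) 0) (homog_expX i 1).
by rewrite /= subnK // -ltnS.
Qed.

Lemma dehomE q :
  dehom q = \sum_(m <- msupp q) q@_m *: 'X^(m 1%R).
Proof.
rewrite {1}[q]mpolyE /dehom raddf_sum; apply: eq_bigr => m _.
by rewrite /= mmapZ -/(dehom _) dehomX mul_polyC.
Qed.

Lemma hom_dehom n q : q \is n.-homog -> hom n (dehom q) = q.
Proof.
move=> qH; rewrite [in RHS](mpolyE q) /hom dehomE.
under eq_bigr => i _ do rewrite coef_sum scaler_suml.
rewrite exchange_big /= big_seq [RHS]big_seq; apply: eq_bigr => m mq.
have dm : mdeg m = n by move/dhomogP: qH; apply.
have lt1 : (m 1%R < n.+1)%N by rewrite ltnS -dm mdeg2 leq_addl.
rewrite (bigD1 (Ordinal lt1)) //= big1 => [|i ne]; last first.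
  rewrite coefZ coefXn (_ : (i : nat) == m 1%R = false) ?mulr0 ?scale0r //.
  by apply: contraNF ne => /eqP e; apply/eqP/val_inj.
by rewrite addr0 coefZ coefXn eqxx mulr1 -dm mdeg2 addnK -(mpolyX2 m).
Qed.

Lemma dehom_hom n p : (size p <= n.+1)%N -> dehom (hom n p) = p.
Proof.
move=> sp; rewrite /hom /dehom raddf_sum /= -[RHS](coefK p).
rewrite poly_def (big_ord_widen _ (fun i => p`_i *: 'X^i) sp).
rewrite [RHS]big_mkcond /=; apply: eq_bigr => i _.
rewrite mmapZ rmorphM /= !rmorphXn /= !mmapX !mmap1U /= expr1n mul1r mul_polyC.
by case: ltnP => // ge; rewrite nth_default ?scale0r.
Qed.

Lemma size_dehom n q : q \is n.-homog -> (size (dehom q) <= n.+1)%N.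
Proof.
move=> qH; rewrite dehomE; apply: (leq_trans (size_sum _ _ _)).
apply/bigmax_leqP_seq => m mq _.
have dm : mdeg m = n by move/dhomogP: qH; apply.
by rewrite (leq_trans (size_scale_leq _ _)) // size_polyXn ltnS -dm mdeg2 leq_addl.
Qed.

Lemma dehom_inj n q r : q \is n.-homog -> r \is n.-homog ->
  dehom q = dehom r -> q = r.
Proof. by move=> qH rH e; rewrite -(hom_dehom qH) e hom_dehom. Qed.

Lemma eval_dehom n q x : q \is n.-homog ->
  q.@[x 0] = \sum_(i < n.+1) (dehom q)`_i * (x 0 0 ^+ (n - i) * x 0 1 ^+ i).
Proof.
move=> qH; rewrite -{1}(hom_dehom qH) raddf_sum; apply: eq_bigr => i _ /=.
by rewrite mevalZ mevalM !rmorphXn /= !mevalXU.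
Qed.

Lemma linear_form_homog x : linear_form x \is 1.-homog.
Proof. by rewrite rpredB // rpredZ // homog_X. Qed.

Lemma eval_linear_form x y :
  (linear_form x).@[y 0] = x 0 1 * y 0 0 - x 0 0 * y 0 1.
Proof. by rewrite mevalB !mevalZ !mevalXU. Qed.

Lemma row2_eq (T : Type) (x y : 'rV[T]_2) : x 0 0 = y 0 0 -> x 0 1 = y 0 1 -> x = y.
Proof.
move=> e0 e1; apply/rowP => i.
case: (unliftP 0 i) => [j ->|-> //].
by rewrite (_ : lift 0 j = 1) //; apply: val_inj; rewrite /= ord1.
Qed.

Lemma row2_neq0 x : (x != 0) = (x 0 0 != 0) || (x 0 1 != 0).
Proof.
apply/idP/idP; last by case/orP; apply: contraNneq => ->; rewrite mxE.
by apply: contra_neqT; rewrite negb_or !negbK => /andP[/eqP e0 /eqP e1];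
  apply: row2_eq; rewrite mxE.
Qed.

Lemma linear_form_neq0 x : x != 0 -> linear_form x != 0.
Proof.
rewrite row2_neq0; apply: contraTneq => e.
have := eval_linear_form x (delta_mx 0 0); have := eval_linear_form x (delta_mx 0 1).
rewrite e !meval0 !mxE !eqxx /= !mulr0 !mulr1 subr0 sub0r => /esym/eqP.
by rewrite oppr_eq0 => -> <-; rewrite eqxx.
Qed.

(** The factor theorem, transported from the affine chart. *)
Lemma factor_zero n q x : q \is n.+1.-homog -> x != 0 -> q.@[x 0] = 0 ->
  exists2 r, r \is n.-homog & q = linear_form x * r.
Proof.
move=> qH; have szq := size_dehom qH.
have homD p : (linear_form x * hom n p) \is n.+1.-homog.
  exact: (@dhomogM _ _ [measure of mdeg] 1 _ n _ (linear_form_homog x) (hom_homog n p)).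
have dl : dehom (linear_form x) = (x 0 1)%:P - x 0 0 *: 'X.
  by rewrite /dehom rmorphB /= !mmapZ !mmapX !mmap1U /= mulr1 mul_polyC.
rewrite row2_neq0 (eval_dehom _ qH).
(* At the point at infinity, vanishing means a zero top coefficient. *)
have [x0 /= x1 e|x0 _ e] := eqVneq (x 0 0) 0.
  have top : (dehom q)`_n.+1 = 0.
    move: e; rewrite big_ord_recr /= subnn expr0 mul1r big1 ?add0r => [/eqP|i _].
      by rewrite mulf_eq0 expf_eq0 (negPf x1) orbF => /eqP.
    by rewrite x0 subSn -1?ltnS // exprS mul0r mul0r mulr0.
  have szr : (size ((x 0 1)^-1 *: dehom q)%R <= n.+1)%N.
    rewrite (leq_trans (size_scale_leq _ _)) //; apply/leq_sizeP => j.
    rewrite leq_eqVlt => /orP[/eqP <- //|lt]; rewrite nth_default //.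
    exact: leq_trans szq lt.
  exists (hom n ((x 0 1)^-1 *: dehom q)); first exact: hom_homog.
  apply: (dehom_inj qH (homD _)).
  by rewrite dehomM dl dehom_hom // x0 scale0r subr0 mul_polyC scalerA divff // scale1r.
have rt : root (dehom q) (x 0 1 / x 0 0).
  rewrite /root (horner_coef_wide _ szq); apply/eqP.
  apply: (mulfI (expf_neq0 n.+1 x0)); rewrite mulr0 -[RHS]e.
  rewrite mulr_sumr; apply: eq_bigr => i _.
  have -> : x 0 0 ^+ n.+1 = x 0 0 ^+ (n.+1 - i) * x 0 0 ^+ i.
    by rewrite -exprD subnK // -ltnS.
  rewrite expr_div_n.
  by have := expf_neq0 i x0 => xi; field.
have /factor_theorem [p ep] := rt.
have szp : (size (- (x 0 0)^-1 *: p)%R <= n.+1)%N.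
  rewrite (leq_trans (size_scale_leq _ _)) //.
  have [->|p0] := eqVneq p 0; first by rewrite size_poly0.
  by move: szq; rewrite ep size_Mmonic ?monicXsubC // size_XsubC addn2.
exists (hom n (- (x 0 0)^-1 *: p)); first exact: hom_homog.
apply: (dehom_inj qH (homD _)); rewrite dehomM dl dehom_hom // ep.
rewrite -!mul_polyC polyCN polyCM.
have : (x 0 0)%:P * ((x 0 0)^-1)%:P = 1 :> {poly K} by rewrite -polyCM divff.
set u := _%:P; set v := _%:P => uv.
rewrite [RHS](_ : _ = p * (u * v * 'X - (x 0 1)%:P * v)); last by ring.
by rewrite uv; ring.
Qed.

Lemma homogC (c : K) : (c%:MP : {mpoly K[2]}) \is 0.-homog.
Proof. by rewrite -[_%:MP]mulr1 mul_mpolyC rpredZ // dhomog1. Qed.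

Lemma homog0 q : q \is 0.-homog -> exists c, q = c%:MP.
Proof.
move=> qH; exists (dehom q)`_0; rewrite -{1}(hom_dehom qH) /hom big_ord1.
by rewrite !expr0 mulr1 -mul_mpolyC mulr1.
Qed.

Lemma homog_vanish n q x : q \is n.-homog -> x != 0 -> q.@[x 0] = 0 ->
  exists2 r, r \is n.-1.-homog & q = linear_form x * r.
Proof.
case: n => [qH x0|n]; last exact: factor_zero.
have [c ->] := homog0 qH; rewrite mevalC => ->.
by exists 0; rewrite ?mulr0 ?dhomog0.
Qed.

Lemma homog_degM m n q r : q \is m.-homog -> q != 0 -> r != 0 ->
  q * r \is n.-homog -> (m <= n)%N.
Proof.
move=> qH q0 r0 qr.
have qr0 : q * r != 0 by rewrite mulf_neq0.
have s q' k : q' != 0 -> q' \is k.-homog -> msize q' = k.+1.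
  move=> q'0 H; have sp : (0 < msize q')%N by rewrite lt0n msize_poly_eq0.
  by have := dhomog_uniq q'0 H (dhomog_msize H) => ->; rewrite prednK.
have := s _ _ qr0 qr; rewrite msizeM // (s _ _ q0 qH) addSn /= => e.
rewrite -ltnS -e -addn1 leq_add2l lt0n.
by rewrite msize_poly_eq0.
Qed.
End Forms.

Section ClosedForms.
Variable K : closedFieldType.
Implicit Types (q r z : {mpoly K[2]}) (x y : 'rV[K]_2) (n m d e : nat).

Definition point (a b : K) : 'rV[K]_2 := \row_j (if j == 0 then a else b).

Lemma point_neq0 (a b : K) : (point a b != 0) = (a != 0) || (b != 0).
Proof. by rewrite row2_neq0 !mxE. Qed.

(** In affine terms: if the degree of the dehomogenized form drops, the point at
infinity (0, 1) is a zero; otherwise a root t gives the zero (1, t). *)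
Lemma form_has_zero n q : q \is n.+1.-homog ->
  exists2 x : 'rV[K]_2, x != 0 & q.@[x 0] = 0.
Proof.
move=> qH; have [top|top] := eqVneq (dehom q)`_n.+1 0.
  exists (point 0 1); first by rewrite point_neq0 oner_neq0 orbT.
  rewrite (eval_dehom _ qH) big_ord_recr /= top mul0r addr0 big1 // => i _.
  by rewrite !mxE /= subSn -1?ltnS // exprS !mul0r mulr0.
have sz : size (dehom q) = n.+2.
  apply/eqP; rewrite eqn_leq size_dehom //=.
  by apply: contraR top; rewrite -leqNgt => le; rewrite nth_default.
have [t] : exists t, root (dehom q) t by apply/closed_rootP; rewrite sz.
rewrite /root (horner_coef_wide _ (size_dehom qH)) => /eqP e.
exists (point 1 t); first by rewrite point_neq0 oner_neq0.
rewrite (eval_dehom _ qH) -[RHS]e; apply: eq_bigr => i _.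
by rewrite !mxE /= expr1n mul1r.
Qed.

Lemma form_vanish n q : q \is n.-homog ->
  (forall x, x != 0 -> q.@[x 0] = 0) -> q = 0.
Proof.
move=> qH q0; apply: (dehom_inj qH); first exact: dhomog0.
rewrite [RHS](_ : _ = 0); last by rewrite /dehom raddf0.
apply/eqP/negP => /negP/closed_nonrootP[t]; rewrite /root.
rewrite (horner_coef_wide _ (size_dehom qH)) => /negP[]; apply/eqP.
rewrite -[RHS](q0 (point 1 t)) ?point_neq0 ?oner_neq0 // (eval_dehom _ qH).
by apply: eq_bigr => i _; rewrite !mxE /= expr1n mul1r.
Qed.

Lemma linear_form_at1 x : x != 0 ->
  exists2 l : {mpoly K[2]}, l \is 1.-homog & l.@[x 0] = 1.
Proof.
rewrite row2_neq0 => /orP[] x0.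
  exists ((x 0 0)^-1 *: 'X_0); first by rewrite rpredZ // homog_X.
  by rewrite mevalZ mevalXU mulVf.
exists ((x 0 1)^-1 *: 'X_1); first by rewrite rpredZ // homog_X.
by rewrite mevalZ mevalXU mulVf.
Qed.

(** * Vectors of forms without common zeros *)

Definition no_common_zero N (f : 'rV[{mpoly K[2]}]_N) :=
  forall x, x != 0 -> eval_at f x != 0.

Lemma exists_nonvanishing N (f : 'rV[{mpoly K[2]}]_N) x :
  eval_at f x != 0 -> exists j, (f 0 j).@[x 0] != 0.
Proof. by case/rV0Pn => j; rewrite mxE; exists j. Qed.

Lemma eval_eq0P N (f : 'rV[{mpoly K[2]}]_N) x :
  eval_at f x = 0 <-> forall j, (f 0 j).@[x 0] = 0.
Proof.
split=> [e j|e]; first by move/rowP/(_ j): e; rewrite !mxE.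
by apply/rowP => j; rewrite !mxE.
Qed.

Definition homog_row N n (v : 'rV[{mpoly K[2]}]_N) := forall j, v 0 j \is n.-homog.

Lemma homog_rowD N n (v w : 'rV[{mpoly K[2]}]_N) :
  homog_row n v -> homog_row n w -> homog_row n (v + w).
Proof. by move=> vH wH j; rewrite mxE rpredD. Qed.

Lemma homog_rowZ N n m c (v : 'rV[{mpoly K[2]}]_N) :
  c \is m.-homog -> homog_row n v -> homog_row (m + n) (c *: v).
Proof. by move=> cH vH j; rewrite mxE; apply: dhomogM cH (vH j). Qed.

Lemma eval_atD N (v w : 'rV[{mpoly K[2]}]_N) x :
  eval_at (v + w) x = eval_at v x + eval_at w x.
Proof. exact: map_mxD. Qed.

Lemma eval_atZ N c (v : 'rV[{mpoly K[2]}]_N) x :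
  eval_at (c *: v) x = c.@[x 0] *: eval_at v x.
Proof. by apply/rowP => j; rewrite !mxE mevalM. Qed.

(** Euclid's lemma without unique factorization: a zero of q is a zero of z,
because some f_j does not vanish there, so its equation can be cancelled from
both q and z, and the degree of q drops. *)
Lemma euclid_lemma N (f : 'rV[{mpoly K[2]}]_N) : no_common_zero f ->
  forall m n q z, q \is m.-homog -> q != 0 -> z \is n.-homog ->
  (forall j, divides q (z * f 0 j)) ->
  exists2 r, r \is (n - m).-homog & z = q * r.
Proof.
move=> fP; elim=> [|m IHm] n q z qH q0 zH dvd.
  have [c ec] := homog0 qH; move: q0; rewrite ec mpolyC_eq0 => c0.
  exists (c^-1 *: z); first by rewrite subn0 rpredZ.
  by rewrite -scalerAr mul_mpolyC scalerA mulVf // scale1r.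
have [x x0 qx] := form_has_zero qH.
have [q' q'H eq] := factor_zero qH x0 qx.
have zx : z.@[x 0] = 0.
  have [j fj] := exists_nonvanishing (fP x x0); have [w ew] := dvd j.
  apply/eqP; have /eqP := congr1 (meval (x 0)) ew.
  by rewrite !mevalM qx mul0r mulf_eq0 (negPf fj) orbF.
have [z' z'H ez] := homog_vanish zH x0 zx.
have l0 := linear_form_neq0 x0.
have q'0 : q' != 0 by apply: contraNneq q0 => e; rewrite eq e mulr0.
have [j|r rH er] := IHm _ _ _ q'H q'0 z'H.
  by have [w ew] := dvd j; exists w; apply: (mulfI l0); rewrite !mulrA -ez -eq.
exists r; last by rewrite ez eq er mulrA.
by rewrite subnS -subn1 -subnDA addnC subnDA subn1.
Qed.

Lemma nonzero_entry N (f : 'rV[{mpoly K[2]}]_N) :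
  no_common_zero f -> exists j, f 0 j != 0.
Proof.
have x0 : point 1 0 != 0 by rewrite point_neq0 oner_neq0.
move=> /(_ _ x0)/exists_nonvanishing[j fj]; exists j.
by apply: contraNneq fj => ->; rewrite meval0.
Qed.

(** The quotient z / f is the same rational function in every coordinate, and
Euclid's lemma shows that it has no denominator. *)
Lemma parallel_multiple N (f z : 'rV[{mpoly K[2]}]_N) d e :
  morphism_of_degree d f -> homog_row e z ->
  (forall i j, z 0 i * f 0 j = z 0 j * f 0 i) ->
  exists2 c, c \is (e - d).-homog & z = c *: f.
Proof.
move=> [fH fP] zH par; have [j fj0] := nonzero_entry fP.
have [k|c cH ec] := euclid_lemma fP (fH j) fj0 (zH j).
  by exists (z 0 k); rewrite (par j k) mulrC.
exists c => //; apply/rowP => i; rewrite mxE; apply: (mulIf fj0).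
by rewrite par ec; ring.
Qed.

Lemma parallel_small N (f z : 'rV[{mpoly K[2]}]_N) d e :
  morphism_of_degree d f -> homog_row e z ->
  (forall i j, z 0 i * f 0 j = z 0 j * f 0 i) -> (e < d)%N -> z = 0.
Proof.
move=> fM zH par lt; have [c cH ez] := parallel_multiple fM zH par.
have [c0|c0] := eqVneq c 0; first by rewrite ez c0 scale0r.
have [j fj0] := nonzero_entry fM.2.
have zj := zH j; rewrite ez mxE mulrC in zj.
by have := homog_degM (fM.1 j) fj0 c0 zj; rewrite leqNgt lt.
Qed.

Lemma homog_vanish_row N n (w : 'rV[{mpoly K[2]}]_N) x :
  homog_row n w -> x != 0 -> eval_at w x = 0 ->
  exists2 w' : 'rV_N, homog_row n.-1 w' & w = linear_form x *: w'.
Proof.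
move=> wH x0 /eval_eq0P wx.
have /fin_all_exists2[w' w'H ew] j := homog_vanish (wH j) x0 (wx j).
exists (\row_j w' j) => [j|]; first by rewrite mxE.
by apply/rowP => j; rewrite !mxE.
Qed.

(** Common zeros are divided out one linear factor at a time. *)
Lemma primitive_part N n (w : 'rV[{mpoly K[2]}]_N) :
  homog_row n w -> w != 0 ->
  exists c, exists u : 'rV[{mpoly K[2]}]_N, exists m, exists m',
    [/\ w = c *: u, c \is m'.-homog, c != 0 & morphism_of_degree m u].
Proof.
elim: n w => [|n IHn] w wH w0.
  exists 1, w, 0%N, 0%N; split; rewrite ?scale1r ?oner_neq0 ?dhomog1 //; split=> // x _.
  apply: contraNneq w0 => /eval_eq0P wx; apply/eqP/rowP => j.
  by have [c ec] := homog0 (wH j); have := wx j; rewrite mxE ec mevalC => ->.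
have [[x [x0 wx]]|nz] := classic (exists x, x != 0 /\ eval_at w x = 0).
  have [w' w'H ew] := homog_vanish_row wH x0 wx.
  have w'0 : w' != 0 by apply: contraNneq w0 => e; rewrite ew e scaler0.
  have [c [u [m [m' [eu cH c0 uM]]]]] := IHn _ w'H w'0.
  exists (linear_form x * c), u, m, (1 + m')%N; split=> //.
  - by rewrite ew eu scalerA.
  - exact: dhomogM (linear_form_homog x) cH.
  - by rewrite mulf_neq0 ?linear_form_neq0.
exists 1, w, n.+1, 0%N; split; rewrite ?scale1r ?oner_neq0 ?dhomog1 //; split=> // x x0.
by apply/eqP => wx; apply: nz; exists x.
Qed.
End ClosedForms.

(** * Cross products *)

Section Cross.
Variable R : comNzRingType.
Implicit Types u v w f : 'rV[R]_3.

Definition i0 : 'I_3 := @Ordinal 3 0 isT.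
Definition i1 : 'I_3 := @Ordinal 3 1 isT.
Definition i2 : 'I_3 := @Ordinal 3 2 isT.

Lemma ord3_ind (P : 'I_3 -> Prop) : P i0 -> P i1 -> P i2 -> forall j, P j.
Proof.
by move=> p0 p1 p2 [[|[|[|//]]] lt]; [move: p0|move: p1|move: p2];
  congr P; apply: val_inj.
Qed.

Lemma sum3 (V : nmodType) (F : 'I_3 -> V) :
  \sum_i F i = F i0 + F i1 + F i2.
Proof.
rewrite !big_ord_recl big_ord0 addr0 addrA.
by congr (F _ + F _ + F _); apply: val_inj.
Qed.

Lemma row3_eq u v :
  u 0 i0 = v 0 i0 -> u 0 i1 = v 0 i1 -> u 0 i2 = v 0 i2 -> u = v.
Proof. by move=> *; apply/rowP; apply: ord3_ind. Qed.

Lemma dot3P u f :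
  u *m f^T = 0 <-> u 0 i0 * f 0 i0 + u 0 i1 * f 0 i1 + u 0 i2 * f 0 i2 = 0.
Proof.
split=> [/matrixP/(_ 0 0)|e]; first by rewrite !mxE sum3 !mxE.
by apply/matrixP => i j; rewrite !ord1 !mxE sum3 !mxE.
Qed.

Definition cross u v : 'rV[R]_3 :=
  \row_j [:: u 0 i1 * v 0 i2 - u 0 i2 * v 0 i1;
             u 0 i2 * v 0 i0 - u 0 i0 * v 0 i2;
             u 0 i0 * v 0 i1 - u 0 i1 * v 0 i0]`_j.

Lemma cross_dotl u v : cross u v *m u^T = 0.
Proof. by apply/dot3P; rewrite !mxE /=; ring. Qed.

Lemma cross_dotr u v : cross u v *m v^T = 0.
Proof. by apply/dot3P; rewrite !mxE /=; ring. Qed.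

(** In coordinates, (u x v) x f = (u . f) v - (v . f) u. *)
Lemma cross_parallel u v f : u *m f^T = 0 -> v *m f^T = 0 ->
  forall i j, cross u v 0 i * f 0 j = cross u v 0 j * f 0 i.
Proof.
move=> /dot3P uf /dot3P vf.
have K (a b a' b' : R) : a - b =
    a' * (u 0 i0 * f 0 i0 + u 0 i1 * f 0 i1 + u 0 i2 * f 0 i2)
    + b' * (v 0 i0 * f 0 i0 + v 0 i1 * f 0 i1 + v 0 i2 * f 0 i2) -> a = b.
  by rewrite uf vf !mulr0 addr0 => /eqP; rewrite subr_eq0 => /eqP.
have c01 : cross u v 0 i0 * f 0 i1 = cross u v 0 i1 * f 0 i0.
  by apply: (K _ _ (v 0 i2) (- u 0 i2)); rewrite !mxE /=; ring.
have c02 : cross u v 0 i0 * f 0 i2 = cross u v 0 i2 * f 0 i0.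
  by apply: (K _ _ (- v 0 i1) (u 0 i1)); rewrite !mxE /=; ring.
have c12 : cross u v 0 i1 * f 0 i2 = cross u v 0 i2 * f 0 i1.
  by apply: (K _ _ (v 0 i0) (- u 0 i0)); rewrite !mxE /=; ring.
by apply: ord3_ind; apply: ord3_ind.
Qed.

Lemma cross_eq0 u v : cross u v = 0 -> forall i j, u 0 i * v 0 j = u 0 j * v 0 i.
Proof.
move=> /rowP e; have := e i0; have := e i1; have := e i2; rewrite !mxE /=.
move=> /eqP; rewrite subr_eq0 => /eqP h2 /eqP; rewrite subr_eq0 => /eqP h1.
move=> /eqP; rewrite subr_eq0 => /eqP h0.
by apply: ord3_ind; apply: ord3_ind.
Qed.

Lemma cross_combl a b u v : cross (a *: u + b *: v) v = a *: cross u v.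
Proof. by apply: row3_eq; rewrite !mxE /=; ring. Qed.

Lemma cross_combr a b u v : cross u (a *: u + b *: v) = b *: cross u v.
Proof. by apply: row3_eq; rewrite !mxE /=; ring. Qed.

Lemma cross_linearl a b u v w :
  cross (a *: u + b *: v) w = a *: cross u w + b *: cross v w.
Proof. by apply: row3_eq; rewrite !mxE /=; ring. Qed.

Lemma cross0l v : cross 0 v = 0.
Proof. by apply: row3_eq; rewrite !mxE /=; ring. Qed.

Lemma cross0r v : cross v 0 = 0.
Proof. by apply: row3_eq; rewrite !mxE /=; ring. Qed.

Definition koszul i f := cross (delta_mx 0 i) f.

Lemma koszul_minors f :
  [/\ koszul i1 f 0 i1 * koszul i2 f 0 i2 - koszul i1 f 0 i2 * koszul i2 f 0 i1
        = f 0 i0 * f 0 i0,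
      koszul i0 f 0 i0 * koszul i2 f 0 i2 - koszul i0 f 0 i2 * koszul i2 f 0 i0
        = f 0 i1 * f 0 i1
    & koszul i0 f 0 i0 * koszul i1 f 0 i1 - koszul i0 f 0 i1 * koszul i1 f 0 i0
        = f 0 i2 * f 0 i2].
Proof.
by rewrite /koszul /cross !mxE -!val_eqE /=; split; ring.
Qed.

Definition stack u v : 'M[R]_(2, 3) :=
  \matrix_(i, j) (if i == 0 then u 0 j else v 0 j).

Lemma mul_stack u v (c : 'rV[R]_2) :
  c *m stack u v = c 0 0 *: u + c 0 1 *: v.
Proof.
apply/rowP => j; rewrite !mxE big_ord_recl big_ord1 !mxE /=.
by congr (_ + c 0 _ * _); apply: val_inj.
Qed.
End Cross.

Lemma orthogonal_plane (K : fieldType) (u w v phi : 'rV[K]_3) :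
  phi != 0 -> (forall a b, a *: u + b *: w = 0 -> a = 0 /\ b = 0) ->
  u *m phi^T = 0 -> w *m phi^T = 0 -> v *m phi^T = 0 ->
  exists a, exists b, v = a *: u + b *: w.
Proof.
move=> phi0 free uf wf vf.
have frS : row_free (stack u w).
  apply: inj_row_free => c; rewrite mul_stack => /free[c0 c1].
  by apply: row2_eq; rewrite mxE.
have sub : (stack u w <= kermx phi^T)%MS.
  apply/sub_kermxP/row_matrixP => i; rewrite row_mul row0.
  have -> : row i (stack u w) = if i == 0 then u else w.
    by apply/rowP => j; rewrite !mxE; case: ifP.
  by case: ifP.
have rk : \rank (kermx phi^T) = 2%N.
  by rewrite mxrank_ker mxrank_tr rank_rV phi0.
have /eqmxP eqS : (stack u w == kermx phi^T)%MS.
  by rewrite -(geq_leqif (mxrank_leqif_eq sub)) rk (eqP frS).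
have : (v <= stack u w)%MS by rewrite eqS; apply/sub_kermxP.
by case/submxP => c; rewrite mul_stack => ->; exists (c 0 0), (c 0 1).
Qed.

Lemma least_nat (P : nat -> Prop) : (exists n, P n) ->
  exists2 n, P n & forall m, (m < n)%N -> ~ P m.
Proof.
case=> n; elim/ltn_ind: n => n IH Pn.
have [[m [lt Pm]]|no] := classic (exists m, (m < n)%N /\ P m); first exact: IH Pm.
by exists n => // m lt Pm; apply: no; exists m.
Qed.

Lemma pihomogM (K : fieldType) n d (p q : {mpoly K[2]}) : q \is d.-homog ->
  pihomog mdeg (n + d) (p * q) = pihomog mdeg n p * q.
Proof.
move=> qH; have piM k : (pihomog mdeg k p * q) \is (k + d).-homog.
  by apply: dhomogM => //; apply: pihomogP.
have le : (msize p <= msize p + n.+1)%N by rewrite leq_addr.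
rewrite {1}(pihomog_partitionE le) mulr_suml raddf_sum /=.
have lt : (n < msize p + n.+1)%N by rewrite addnS ltnS leq_addl.
rewrite (bigD1 (Ordinal lt)) //= (pihomog_dE (piM n)) big1 ?addr0 // => i ne.
apply: pihomog_ne0 (piM i); rewrite eqn_add2r eq_sym.
by apply: contraNneq ne => e; apply/eqP/val_inj.
Qed.

(** * Syzygies of three forms *)

Section FormRows.
Variable K : closedFieldType.
Implicit Types (v w : 'rV[{mpoly K[2]}]_3) (x : 'rV[K]_2).

Lemma homog_cross n m v w :
  homog_row n v -> homog_row m w -> homog_row (n + m) (cross v w).
Proof.
move=> vH wH; have P i j : (v 0 i * w 0 j) \is (n + m).-homog.
  by apply: dhomogM (vH i) (wH j).
by apply: ord3_ind; rewrite mxE /= rpredB.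
Qed.

Lemma eval_cross v w x :
  eval_at (cross v w) x = cross (eval_at v x) (eval_at w x).
Proof. by apply: row3_eq; rewrite !mxE /= mevalB !mevalM. Qed.

Lemma eval_syzygy v w x : v *m w^T = 0 -> eval_at v x *m (eval_at w x)^T = 0.
Proof.
have -> : (eval_at w x)^T = map_mx (meval (x 0)) w^T.
  by apply/matrixP => i j; rewrite !mxE.
by move=> e; rewrite /eval_at -map_mxM e map_mx0.
Qed.
End FormRows.

Section Syzygies.
Variables (K : closedFieldType) (d : nat) (f : 'rV[{mpoly K[2]}]_3).
Hypothesis fM : morphism_of_degree d f.
Implicit Types (v w : 'rV[{mpoly K[2]}]_3) (x : 'rV[K]_2).

Lemma syzygyD v w : v *m f^T = 0 -> w *m f^T = 0 -> (v + w) *m f^T = 0.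
Proof. by move=> v0 w0; rewrite mulmxDl v0 w0 addr0. Qed.

Lemma syzygyZ c v : v *m f^T = 0 -> (c *: v) *m f^T = 0.
Proof. by move=> v0; rewrite -scalemxAl v0 scaler0. Qed.

Lemma syzygy_cancel c v : c != 0 -> (c *: v) *m f^T = 0 -> v *m f^T = 0.
Proof.
move=> c0; rewrite -scalemxAl => /matrixP/(_ 0 0); rewrite [_ 0 0]mxE [RHS]mxE.
move=> /eqP; rewrite mulf_eq0 (negPf c0) /= => /eqP e.
by apply/matrixP => i j; rewrite !ord1 e mxE.
Qed.

Lemma syzygy_divide n v x : homog_row n v -> v *m f^T = 0 -> x != 0 ->
  eval_at v x = 0 ->
  exists v', [/\ homog_row n.-1 v', v' *m f^T = 0 & v = linear_form x *: v'].
Proof.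
move=> vH vS x0 vx; have [v' v'H ev] := homog_vanish_row vH x0 vx.
exists v'; split=> //; apply: (@syzygy_cancel (linear_form x)).
  exact: linear_form_neq0.
by rewrite -ev.
Qed.

(** The Koszul syzygies e_i x f cannot all be multiples of one vector: their
2 x 2 minors would vanish, but these include the squares of the entries of f. *)
Lemma koszul_not_multiples v : exists w,
  [/\ homog_row d w, w *m f^T = 0 & ~ exists c, w = c *: v].
Proof.
have [fH _] := fM.
pose k i := koszul i f.
have kH i : homog_row d (k i).
  have D : homog_row 0 (delta_mx 0 i : 'rV[{mpoly K[2]}]_3).
    by move=> j; rewrite mxE; case: (_ && _); rewrite ?dhomog1 ?dhomog0.
  exact: homog_cross D fH.
have kS i : k i *m f^T = 0 by apply: cross_dotr.
apply: NNPP => no.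
have mul i : exists c, k i = c *: v.
  by apply: NNPP => ni; apply: no; exists (k i).
have [a0 k0] := mul i0; have [a1 k1] := mul i1; have [a2 k2] := mul i2.
have minor i j a b s t : k i = a *: v -> k j = b *: v ->
    k i 0 s * k j 0 t - k i 0 t * k j 0 s = 0.
  by move=> -> ->; rewrite !mxE; ring.
have [m0 m1 m2] := koszul_minors f.
have h0 := minor i1 i2 _ _ i1 i2 k1 k2; have h1 := minor i0 i2 _ _ i0 i2 k0 k2.
have h2 := minor i0 i1 _ _ i0 i1 k0 k1; rewrite /k m0 in h0; rewrite /k m1 in h1.
rewrite /k m2 in h2.
have sq (p : {mpoly K[2]}) : p * p = 0 -> p == 0 by move/eqP; rewrite mulf_eq0 orbb.
have [j] := nonzero_entry fM.2; apply/negP; rewrite negbK; move: j; apply: ord3_ind.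
- exact: sq h0.
- exact: sq h1.
- exact: sq h2.
Qed.

(** Two syzygies u and t chosen greedily: u of least degree a, and t of least
degree b among the syzygies that are not multiples of u. *)
Section MinimalSyzygies.
Variables (a b : nat) (u t : 'rV[{mpoly K[2]}]_3).
Hypotheses (a_gt0 : (0 < a)%N) (le_ab : (a <= b)%N).
Hypotheses (uH : homog_row a u) (uS : u *m f^T = 0) (u_neq0 : u != 0).
Hypothesis u_min : forall m v,
  (m < a)%N -> homog_row m v -> v *m f^T = 0 -> v = 0.
Hypotheses (tH : homog_row b t) (tS : t *m f^T = 0).
Hypothesis t_new : ~ exists c, t = c *: u.
Hypothesis t_min : forall m v,
  (m < b)%N -> homog_row m v -> v *m f^T = 0 -> exists c, v = c *: u.

(** A combination of u and t vanishing at x, once made homogeneous, is divisible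
by the equation of x; the quotient is a syzygy of smaller degree, against the
minimality of u or t. *)
Lemma minimal_syzygies_independent x : x != 0 -> forall al be,
  al *: eval_at u x + be *: eval_at t x = 0 -> al = 0 /\ be = 0.
Proof.
move=> x0 al be e; have [l lH lx] := linear_form_at1 x0.
have lbH : l ^+ (b - a) \is (b - a).-homog.
  by have := dhomogMn (b - a) lH; rewrite mul1n.
(* The power of l equalizes the degrees without changing the value at x. *)
pose z := (al *: l ^+ (b - a)) *: u + be%:MP *: t.
have zH : homog_row b z.
  have uH' : homog_row (b - a + a) ((al *: l ^+ (b - a)) *: u).
    by apply: homog_rowZ; rewrite ?rpredZ.
  have tH' : homog_row (0 + b) (be%:MP *: t).
    by apply: homog_rowZ; rewrite ?homogC.
  by rewrite subnK // in uH'; apply: homog_rowD.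
have zS : z *m f^T = 0 by apply: syzygyD; apply: syzygyZ.
have zx : eval_at z x = 0.
  by rewrite /z eval_atD !eval_atZ mevalZ mevalC rmorphXn /= lx expr1n mulr1.
have [z' [z'H z'S ez]] := syzygy_divide zH zS x0 zx.
have [c ec] : exists c, z' = c *: u.
  by apply: (t_min (m := b.-1)) => //; rewrite prednK // (leq_trans a_gt0).
have be0 : be = 0.
  apply/eqP/negP => /negP be0; apply: t_new.
  exists ((be^-1)%:MP * (linear_form x * c - al *: l ^+ (b - a))).
  rewrite -scalerA scalerBl -scalerA -ec -ez /z addrC addKr scalerA -mpolyCM.
  by rewrite mulVf // scale1r.
split=> //; apply/eqP/negP => /negP al0; move/negP: u_neq0; apply.
have ux : eval_at u x = 0.
  move/eqP: e; rewrite be0 scale0r addr0 scaler_eq0 (negPf al0) /=.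
  by move/eqP.
have [u' [u'H u'S eu]] := syzygy_divide uH uS x0 ux.
by rewrite eu (u_min _ u'H u'S) ?scaler0 // prednK.
Qed.

Lemma minimal_syzygies_cross : no_common_zero (cross u t).
Proof.
move=> x x0; have free := minimal_syzygies_independent x0.
rewrite eval_cross; apply/eqP => /cross_eq0 e.
have ut0 j : eval_at u x 0 j = 0.
  apply: (proj2 (free (- eval_at t x 0 j) (eval_at u x 0 j) _)).
  apply/rowP => i; move: (eval_at u x) (eval_at t x) e => U T e.
  by rewrite !mxE mulNr mulrC e addNr.
suff /free[/eqP] : 1 *: eval_at u x + 0 *: eval_at t x = 0 by rewrite oner_eq0.
by rewrite scale1r scale0r addr0; apply/rowP => j; rewrite ut0 mxE.
Qed.

(** Both u x t and f are orthogonal to u and t and have no common zeros, so they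
agree up to a constant. *)
Lemma minimal_syzygies_degree : (a + b)%N = d.
Proof.
have NH : homog_row (a + b) (cross u t) by apply: homog_cross.
have par := cross_parallel uS tS.
have x1 : point 1 0 != 0 :> 'rV[K]_2 by rewrite point_neq0 oner_neq0.
case: (ltngtP (a + b) d) => // [lt|gt].
  case/eqP: (minimal_syzygies_cross x1); rewrite (parallel_small fM NH par lt).
  by apply/eval_eq0P => j; rewrite mxE meval0.
have [c cH ec] := parallel_multiple fM NH par.
have [x x0 cx] : exists2 x : 'rV[K]_2, x != 0 & c.@[x 0] = 0.
  by apply: (@form_has_zero _ (a + b - d).-1); rewrite prednK ?subn_gt0.
by have := minimal_syzygies_cross x0; rewrite ec eval_atZ cx scale0r eqxx.
Qed.

(** At the point (1, 0) the vectors u and t span the plane orthogonal to f, so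
subtracting suitable multiples of u and t makes a syzygy vanish there; then it
is divisible by a linear form, and induction on the degree applies. *)
Lemma minimal_syzygies_span_homog m v : homog_row m v -> v *m f^T = 0 ->
  exists ga, exists de, v = ga *: u + de *: t.
Proof.
have [_ fP] := fM; elim: m v => [|m IHm] v vH vS.
  by exists 0, 0; rewrite !scale0r addr0; apply: u_min vH vS.
have [lt|leb] := ltnP m.+1 b.
  by have [c ->] := t_min lt vH vS; exists c, 0; rewrite scale0r addr0.
have x1 : point 1 0 != 0 :> 'rV[K]_2 by rewrite point_neq0 oner_neq0.
have [al [be ev]] := orthogonal_plane (fP _ x1) (minimal_syzygies_independent x1)
  (eval_syzygy _ uS) (eval_syzygy _ tS) (eval_syzygy _ vS).
pose ca : {mpoly K[2]} := - al *: 'X_0 ^+ (m.+1 - a).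
pose cb : {mpoly K[2]} := - be *: 'X_0 ^+ (m.+1 - b).
pose z := v + (ca *: u + cb *: t).
have zH : homog_row m.+1 z.
  have uH' : homog_row (m.+1 - a + a) (ca *: u).
    by apply: homog_rowZ; rewrite ?rpredZ ?homog_expX.
  have tH' : homog_row (m.+1 - b + b) (cb *: t).
    by apply: homog_rowZ; rewrite ?rpredZ ?homog_expX.
  rewrite subnK // in tH'; rewrite subnK ?(leq_trans le_ab) // in uH'.
  by do 2?apply: homog_rowD.
have zS : z *m f^T = 0 by do ?apply: syzygyD; rewrite ?syzygyZ.
have zx : eval_at z (point 1 0) = 0.
  rewrite /z /ca /cb !eval_atD !eval_atZ !mevalZ !rmorphXn /= !mevalXU !mxE /=.
  by rewrite !expr1n !mulr1 ev !scaleNr -opprD subrr.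
have [z' [z'H z'S ez]] := syzygy_divide zH zS x1 zx.
have [ga [de e']] := IHm _ z'H z'S.
exists (linear_form (point 1 0) * ga - ca), (linear_form (point 1 0) * de - cb).
by rewrite !scalerBl -!scalerA addrACA -scalerDr -e' -ez /z -opprD addrK.
Qed.

Lemma minimal_syzygies_span v : v *m f^T = 0 ->
  exists ga, exists de, v = ga *: u + de *: t.
Proof.
move=> vS; pose N := (\max_(j < 3) msize (v 0%R j))%N.
have leN j : (msize (v 0%R j) <= N)%N by apply: (leq_bigmax j).
pose vn m : 'rV_3 := map_mx (pihomog mdeg m) v.
(* As f is homogeneous, each homogeneous component of v is a syzygy. *)
have vnS m : vn m *m f^T = 0.
  have /matrixP/(_ 0 0) := vS; rewrite [LHS]mxE [RHS]mxE.
  move=> /(congr1 (pihomog mdeg (m + d))); rewrite raddf0 raddf_sum /= => e.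
  apply/matrixP => i j; rewrite !ord1 [LHS]mxE [RHS]mxE -[RHS]e.
  by apply: eq_bigr => k _; rewrite !mxE (pihomogM _ _ (fM.1 k)).
have vnE (m : 'I_N) : exists c, vn m = c.1 *: u + c.2 *: t.
  have vnH : homog_row m (vn m) by move=> j; rewrite mxE pihomogP.
  by have [ga [de e]] := minimal_syzygies_span_homog vnH (vnS m); exists (ga, de).
have [c ec] := fin_all_exists vnE.
exists (\sum_m (c m).1), (\sum_m (c m).2).
rewrite !scaler_suml -big_split; transitivity (\sum_(m < N) vn m).
  apply/rowP => j; rewrite summxE {1}(pihomog_partitionE (leN j)).
  by apply: eq_bigr => m _; rewrite !mxE.
by apply: eq_bigr => m _; rewrite ec.
Qed.

Lemma minimal_syzygies_free ga de : ga *: u + de *: t = 0 -> ga = 0 /\ de = 0.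
Proof.
move=> e; have [j Nj] := nonzero_entry minimal_syzygies_cross.
have c0 := cross_combl ga de u t; rewrite e cross0l in c0.
have c1 := cross_combr ga de u t; rewrite e cross0r in c1.
have z0 (k : {mpoly K[2]}) : k *: cross u t = 0 -> k = 0.
  move=> /rowP/(_ j); rewrite [LHS]mxE [RHS]mxE => /eqP.
  by rewrite mulf_eq0 (negPf Nj) orbF => /eqP.
by split; apply: z0.
Qed.
End MinimalSyzygies.

(** The greedily chosen syzygies u and t are the rows of the resolution. The
given syzygy w bounds the degree a of u, and hence 2 a <= d. Minimality of the
resolution is the positivity of a, the absence of constant syzygies. *)
Lemma syzygy_resolution n w :
  (forall v, homog_row 0 v -> v *m f^T = 0 -> v = 0) ->
  homog_row n w -> w != 0 -> w *m f^T = 0 -> (2 * n <= d)%N ->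
  exists2 a, (a <= n)%N & splitting_type d f a.
Proof.
move=> no_const wH w0 wS len.
pose Pa a := exists v, [/\ homog_row a v, v *m f^T = 0 & v != 0].
have [a [u [uH uS u0]] amin] : exists2 a, Pa a & forall m, (m < a)%N -> ~ Pa m.
  by apply: least_nat; exists n, w.
have u_min m v : (m < a)%N -> homog_row m v -> v *m f^T = 0 -> v = 0.
  move=> lt vH vS; apply/eqP/negP => /negP v0.
  by apply: (amin _ lt); exists v.
pose Pb b := exists v, [/\ homog_row b v, v *m f^T = 0 & ~ exists c, v = c *: u].
have [b [t [tH tS tN]] bmin] : exists2 b, Pb b & forall m, (m < b)%N -> ~ Pb m.
  by apply: least_nat; exists d; apply: koszul_not_multiples.
have t_min m v : (m < b)%N -> homog_row m v -> v *m f^T = 0 -> exists c, v = c *: u.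
  by move=> lt vH vS; apply: NNPP => no; apply: (bmin _ lt); exists v.
have t0 : t != 0 by apply/eqP => e; apply: tN; exists 0; rewrite scale0r.
have a_gt0 : (0 < a)%N.
  rewrite lt0n; apply/eqP => e; rewrite e in uH; move/eqP: u0; apply.
  exact: no_const uH uS.
have leab : (a <= b)%N.
  by rewrite leqNgt; apply: contraNN t0 => lt; rewrite (u_min _ _ lt tH tS).
have le_an : (a <= n)%N.
  by rewrite leqNgt; apply: contraNN w0 => lt; rewrite (u_min _ _ lt wH wS).
have eab := minimal_syzygies_degree a_gt0 leab uH uS u0 u_min tH tS tN t_min.
exists a => //; split; first by rewrite (leq_trans _ len) ?leq_pmul2l.
have b_gt0 : (0 < b)%N := leq_trans a_gt0 leab.
exists (stack u t); split.
- by split=> j; rewrite mxE //= -eab addKn.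
- move=> i j; rewrite mxE; case: ifP => _.
    by apply: (dhomog_nemf_coeff (uH j)); rewrite /= mdeg0 eq_sym -lt0n.
  by apply: (dhomog_nemf_coeff (tH j)); rewrite /= mdeg0 eq_sym -lt0n.
- move=> v; split=> [vS|[c ->]].
    have [ga [de ->]] :=
      minimal_syzygies_span a_gt0 leab uH uS u0 u_min tH tS tN t_min vS.
    by exists (\row_j (if j == 0 then ga else de)); rewrite mul_stack !mxE.
  by rewrite mul_stack; apply: syzygyD; apply: syzygyZ.
move=> c; rewrite mul_stack.
case/(minimal_syzygies_free a_gt0 leab uH uS u0 u_min tH tS tN t_min) => c0 c1.
by apply: row2_eq; rewrite mxE.
Qed.
End Syzygies.

(** * Curves contained in a line *)

Section NotInLine.
Variable K : closedFieldType.
Implicit Types (x y : 'rV[K]_2).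

Lemma parallel_eqmx N (u v : 'rV[K]_N) : u != 0 -> v != 0 ->
  (forall i j, u 0 i * v 0 j = u 0 j * v 0 i) -> (u == v)%MS.
Proof.
have sub (a b : 'rV[K]_N) : b != 0 ->
    (forall i j, a 0 i * b 0 j = a 0 j * b 0 i) -> (a <= b)%MS.
  move=> /rV0Pn[j bj] par; apply/sub_rVP; exists (a 0 j / b 0 j).
  by apply/rowP => i; rewrite mxE mulrAC -par mulfK.
move=> u0 v0 par; rewrite !sub // => i j.
by rewrite mulrC -par mulrC.
Qed.

Lemma eqmx_linear_form x y : (x == y)%MS -> (linear_form x).@[y 0] = 0.
Proof.
by case/andP => _ /sub_rVP[a ->]; rewrite eval_linear_form !mxE; ring.
Qed.

(** Zeros can be split off one at a time, and each is proportional to x. *)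
Lemma single_zero n x (q : {mpoly K[2]}) : x != 0 -> q \is n.-homog ->
  (forall y, y != 0 -> q.@[y 0] = 0 -> (x == y)%MS) ->
  exists c, q = c *: linear_form x ^+ n.
Proof.
move=> x0; elim: n q => [|n IHn] q qH zeros.
  have [c ->] := homog0 qH; exists c.
  by rewrite expr0 -mul_mpolyC mulr1.
have [y y0 qy] := form_has_zero qH.
have [r rH eq] := factor_zero qH y0 qy.
have [c er] : exists c, r = c *: linear_form x ^+ n.
  by apply: IHn => // t t0 rt; apply: zeros => //; rewrite eq mevalM rt mulr0.
have /andP[_ /sub_rVP[a ey]] := zeros y y0 qy.
exists (a * c); rewrite eq er exprS ey /linear_form !mxE -!scalerA -scalerBr.
by rewrite -scalerAl -scalerAr.
Qed.

Lemma exists_notin (s : seq K) : exists z, z \notin s.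
Proof.
have /closed_nonrootP[z] : \prod_(a <- s) ('X - a%:P) != 0.
  by rewrite monic_neq0 // monic_prod_XsubC.
by rewrite root_prod_XsubC; exists z.
Qed.

Lemma point_notin (E : seq 'rV[K]_2) z :
  z \notin [seq e 0 1 / e 0 0 | e : 'rV[K]_2 <- E] ->
  ~~ has (fun e => (point 1 z == e)%MS) E.
Proof.
apply: contra => /hasP[e eE /andP[/sub_rVP[a ee] _]].
apply/mapP; exists e => //; move/rowP: ee => ee.
have := ee 0; have := ee 1; rewrite !mxE /= => -> e1.
have a0 : a != 0 by apply: contra_eqN e1 => /eqP->; rewrite mul0r oner_neq0.
have e0 : e 0 0 != 0 by apply: contra_eqN e1 => /eqP->; rewrite mulr0 oner_neq0.
apply: (mulIf e0); rewrite divfK // -mulrA [e 0 1 * _]mulrC mulrA.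
by rewrite -e1 mul1r.
Qed.

(** Comparing the coefficients of t in the two sides, by taking derivatives
at 0: the left one is d g A^(d-1) B, the right one is 0 as d > 1. *)
Lemma powers_independent d (g b a D A B : K) : [pchar K] =i pred0 -> (1 < d)%N ->
  (forall t, g * (A + t * B) ^+ d = a * (t * D) ^+ d + b) -> g * A * B = 0.
Proof.
move=> charK0 d_gt1 e.
pose P : {poly K} := g%:P * (A%:P + B%:P * 'X) ^+ d - (a * D ^+ d)%:P * 'X^d - b%:P.
have P0 : P = 0.
  apply/eqP/negP => /negP/closed_nonrootP[t]; rewrite /root !hornerE.
  by rewrite [B * t]mulrC e exprMn; apply/negP; rewrite negbK; apply/eqP; ring.
have : P^`().[0] = 0 by rewrite P0 deriv0 horner0.
rewrite /P !derivE deriv_exp !derivE !(mul0r, add0r, mulr1).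
rewrite !(hornerE, hornerMn) /=.
have d1 : d.-1 == 0%N = false by case: d d_gt1 {e P P0} => [|[]].
rewrite !expr0n d1 !(mul0rn, mulr0, subr0, mulr0n).
move/eqP; rewrite -mulr_natr !mulf_eq0 ((pcharf0P K).1 charK0).
have -> : d == 0%N = false by case: d d_gt1 {e P P0 d1}.
rewrite expf_eq0 orbF => /or3P[] /eqP => [->|->|]; rewrite ?mul0r ?mulr0 //.
by move/eqP/andP => [_ /eqP->]; rewrite mulr0 mul0r.
Qed.

(** A constant syzygy mu puts the image of f in a line, and then f is a map of
degree d from the projective line to itself. For x outside the exceptional set
E, the points y with f(y) = f(x) are the zeros of a form F_x of degree d in y,
and injectivity forces F_x = c (linear_form x)^d. All the forms F_x lie in a
pencil, so three of them satisfy a linear relation; but in characteristic 0 and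
for d > 1 three d-th powers of pairwise independent linear forms do not. *)
Lemma not_in_line d (f : 'rV[{mpoly K[2]}]_3) : [pchar K] =i pred0 ->
  (1 < d)%N -> morphism_of_degree d f -> generically_injective f ->
  forall v : 'rV[{mpoly K[2]}]_3, homog_row 0 v ->
  v *m f^T = 0 -> v = 0.
Proof.
move=> charK0 d_gt1 [fH fP] [E inj] v vH vf.
apply/eqP/negP => /negP v0.
have [mu ev] : exists mu : 'rV[K]_3, v = map_mx (@mpolyC 2 K) mu.
  have /fin_all_exists[mu emu] j := homog0 (vH j).
  by exists (\row_j mu j); apply/rowP => j; rewrite !mxE.
have mu0 : mu != 0 by apply: contraNneq v0 => e; rewrite ev e map_mx0.
have muf x : eval_at f x *m mu^T = 0.
  have -> : mu = eval_at v x by apply/rowP => j; rewrite ev !mxE mevalC.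
  by apply: eval_syzygy; rewrite -[LHS]trmxK trmx_mul trmxK vf trmx0.
have [j muj] := rV0Pn _ mu0.
(* The vector f(x) x f(y) is a multiple of mu, so its j-th entry detects it. *)
pose F x := cross (const_form (eval_at f x)) f 0 j.
have FE x y : (F x).@[y 0] = cross (eval_at f x) (eval_at f y) 0 j.
  have cst : eval_at (const_form (eval_at f x)) y = eval_at f x.
    by apply/rowP => k; rewrite !mxE mevalC.
  have := eval_cross (const_form (eval_at f x)) f y => /rowP/(_ j).
  by rewrite cst => <-; rewrite [RHS]mxE.
have FH x : F x \is d.-homog.
  have H : homog_row 0 (const_form (eval_at f x)) by move=> k; rewrite mxE homogC.
  exact: (homog_cross H fH j).
have F0 x y : x != 0 -> y != 0 -> (F x).@[y 0] = 0 -> (eval_at f x == eval_at f y)%MS.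
  move=> x0 y0; rewrite FE => e; apply: parallel_eqmx; [exact: fP|exact: fP|].
  apply: cross_eq0; apply/rowP => i; rewrite [RHS]mxE; apply: (mulIf muj).
  by rewrite (cross_parallel (muf x) (muf y)) e !mul0r.
clearbody F.
pose s := [seq e 0 1 / e 0 0 | e : 'rV[K]_2 <- E].
have [z1 z1s] := exists_notin s.
have [z2 ] := exists_notin (z1 :: s); rewrite inE negb_or => /andP[z21 z2s].
have [z3 ] := exists_notin (z1 :: z2 :: s); rewrite !inE !negb_or => /and3P[z31 z32 z3s].
have pt0 z : point 1 z != 0 :> 'rV[K]_2 by rewrite point_neq0 oner_neq0.
have sep z w : z \notin s -> z != w ->
    ~~ (eval_at f (point 1 z) == eval_at f (point 1 w))%MS.
  move=> zs; apply: contraNN => e; rewrite -subr_eq0; apply/eqP.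
  have := eqmx_linear_form (inj _ _ (pt0 z) (pt0 w) (point_notin zs) e).
  by rewrite eval_linear_form !mxE /= mulr1 mul1r.
have pw z : z \notin s -> exists c, F (point 1 z) = c *: linear_form (point 1 z) ^+ d.
  move=> zs; apply: single_zero => // y y0 Fy.
  by apply: inj => //; [apply: point_notin|apply: F0].
have [c1 E1] := pw _ z1s; have [c2 E2] := pw _ z2s; have [c3 E3] := pw _ z3s.
have free a b : a *: eval_at f (point 1 z1) + b *: eval_at f (point 1 z2) = 0 ->
    a = 0 /\ b = 0.
  move=> e.
  have /negPf ne : cross (eval_at f (point 1 z1)) (eval_at f (point 1 z2)) != 0.
    have := sep _ _ z1s; rewrite eq_sym in z21; move/(_ _ z21).
    apply: contraNneq => /cross_eq0.
    by apply: parallel_eqmx; apply: fP.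
  have := cross_combl a b (eval_at f (point 1 z1)) (eval_at f (point 1 z2)).
  have := cross_combr a b (eval_at f (point 1 z1)) (eval_at f (point 1 z2)).
  rewrite e cross0l cross0r => /esym/eqP; rewrite scaler_eq0 ne orbF => /eqP->.
  by move/esym/eqP; rewrite scaler_eq0 ne orbF => /eqP->.
have [al [be e3]] := orthogonal_plane mu0 free (muf _) (muf _) (muf (point 1 z3)).
have Flin y : (F (point 1 z3)).@[y 0] =
    al * (F (point 1 z1)).@[y 0] + be * (F (point 1 z2)).@[y 0].
  rewrite !FE e3 cross_linearl; move: (cross _ _) (cross _ _) => X Y.
  by rewrite !mxE.
(* The relation between the three powers, along the line of points x1 + t x2. *)
have /eqP : c3 * (z3 - z1) * (z3 - z2) = 0.
  apply: (@powers_independent d _ (be * c2 * (z2 - z1) ^+ d) (al * c1) (z1 - z2)) => // t.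
  have := Flin (point 1 z1 + t *: point 1 z2); rewrite E1 E2 E3 !mevalZ !rmorphXn /=.
  rewrite !eval_linear_form !mxE /= => h.
  rewrite [RHS](_ : _ = al * (c1 * (z1 * (1 + t * 1) - 1 * (z1 + t * z2)) ^+ d)
    + be * (c2 * (z2 * (1 + t * 1) - 1 * (z1 + t * z2)) ^+ d)).
    by rewrite -h; congr (_ * _ ^+ _); ring.
  by rewrite !mulrA; congr (_ * _ ^+ _ + _ * _ ^+ _); ring.
rewrite !mulf_eq0 !subr_eq0 (negPf z31) (negPf z32) !orbF => /eqP c30.
case/negP: (sep _ _ z3s z31); apply: F0 => //.
by rewrite E3 c30 scale0r meval0.
Qed.
End NotInLine.

(** * Unisecant curves on a scroll *)

Section Scroll.
Variable K : closedFieldType.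
Implicit Types (x p : 'rV[K]_2).

Lemma eval_const_mul m n (g : 'rV[{mpoly K[2]}]_m) (C : 'M[K]_(m, n)) x :
  eval_at (g *m const_form C) x = eval_at g x *m C.
Proof.
rewrite /eval_at map_mxM; congr (_ *m _); apply/matrixP => i j.
by rewrite !mxE /= mevalC.
Qed.

Lemma const_formM m n q (C : 'M[K]_(m, n)) (D : 'M[K]_(n, q)) :
  const_form (C *m D) = const_form C *m const_form D.
Proof. exact: map_mxM. Qed.

Lemma homog_row_const m n d (g : 'rV[{mpoly K[2]}]_m) (C : 'M[K]_(m, n)) :
  homog_row d g -> homog_row d (g *m const_form C).
Proof.
move=> gH j; rewrite mxE; apply: rpred_sum => i _.
by rewrite mxE mulrC mul_mpolyC rpredZ.
Qed.

Definition veronese_form n (s : 'rV[{mpoly K[2]}]_2) : 'rV[{mpoly K[2]}]_n.+1 :=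
  \row_i (s 0 0 ^+ (n - i) * s 0 1 ^+ i).

Lemma eval_veronese_form n s x :
  eval_at (veronese_form n s) x = veronese n (eval_at s x).
Proof. by apply/rowP => i; rewrite !mxE mevalM !rmorphXn. Qed.

Lemma veronese_neq0 n p : p != 0 -> veronese n p != 0.
Proof.
rewrite row2_neq0 => /orP[] p0; apply/eqP => /rowP.
  by move/(_ ord0)/eqP; rewrite !mxE subn0 expr0 mulr1 expf_eq0 (negPf p0) andbF.
move/(_ ord_max)/eqP; rewrite !mxE /= subnn expr0 mul1r expf_eq0 (negPf p0).
by rewrite andbF.
Qed.

Lemma veroneseZ n c p : veronese n (c *: p) = c ^+ n *: veronese n p.
Proof.
apply/rowP => i; rewrite !mxE !exprMn.
have -> : c ^+ n = c ^+ (n - i) * c ^+ i by rewrite -exprD subnK // -ltnS.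
by ring.
Qed.

Lemma veronese_form_morphism n m s : morphism_of_degree m s ->
  morphism_of_degree (m * n) (veronese_form n s).
Proof.
case=> sH sP; split=> [i|x x0]; last first.
  by rewrite eval_veronese_form veronese_neq0 ?sP.
rewrite mxE; have := dhomogM (dhomogMn (n - i) (sH 0)) (dhomogMn i (sH 1)).
by rewrite /= -mulnDr subnK // -ltnS.
Qed.

(** Consecutive entries of the Veronese point of p are proportional to the
coordinates of p. *)
Lemma consecutive_entries n d (w : 'rV[{mpoly K[2]}]_n.+1) : (0 < n)%N ->
  homog_row d w -> w != 0 -> exists s : 'rV[{mpoly K[2]}]_2,
  [/\ homog_row d s, s != 0 & forall x p c,
      eval_at w x = c *: veronese n p -> exists c', eval_at s x = c' *: p].
Proof.
case: n w => [//|n] w _ wH w0.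
pose s i : 'rV[{mpoly K[2]}]_2 :=
  \row_j (if j == 0 then w 0 (widen_ord (leqnSn _) i) else w 0 (lift ord0 i)).
have [i si] : exists i, s i != 0.
  have [j wj] := rV0Pn _ w0; case: (unliftP ord0 j) => [i ej|ej].
    by exists i; apply: contraNneq wj => /rowP/(_ 1); rewrite !mxE /= ej => ->.
  exists ord0; apply: contraNneq wj => /rowP/(_ 0); rewrite !mxE /= ej => <-.
  by rewrite (_ : widen_ord _ _ = ord0) //; apply: val_inj.
exists (s i); split=> // [j|x p c /rowP e]; first by rewrite mxE; case: ifP.
exists (c * (p 0 0 ^+ (n - i) * p 0 1 ^+ i)).
have lein : (i <= n)%N by rewrite -ltnS.
have h0 := e (widen_ord (leqnSn _) i); have h1 := e (lift ord0 i).
rewrite !mxE /= in h0 h1.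
apply: row2_eq; rewrite !mxE /=.
  by rewrite h0 subSn // exprS; ring.
by rewrite h1 subSS exprS; ring.
Qed.

(** Where c does not vanish, s is proportional to the parameter p of the point,
so that w is proportional to the Veronese point of s. The minors multiplied by
c thus vanish everywhere, and c is not zero. *)
Lemma veronese_parallel n d m e (w : 'rV[{mpoly K[2]}]_n.+1) s c :
  homog_row d w -> morphism_of_degree m s -> c \is e.-homog -> c != 0 ->
  (forall x, x != 0 -> exists p, (exists b, eval_at w x = b *: veronese n p) /\
     (exists b, eval_at (c *: s) x = b *: p)) ->
  forall i j, w 0 i * veronese_form n s 0 j = w 0 j * veronese_form n s 0 i.
Proof.
move=> wH sM cH c0 pt i j; have [vH _] := veronese_form_morphism n sM.
have H k l : (w 0 k * veronese_form n s 0 l) \is (d + m * n).-homog.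
  by apply: dhomogM (wH k) (vH l).
apply/eqP; rewrite -subr_eq0 -(inj_eq (mulfI c0)) mulr0; apply/eqP.
apply: (@form_vanish _ (e + (d + m * n))) => [|x x0].
  by apply: dhomogM cH _; apply: rpredB; apply: H.
have [p [[b ew] [b' es]]] := pt x x0.
rewrite mevalM; have [->|cx] := eqVneq c.@[x 0] 0; first by rewrite mul0r.
rewrite eval_atZ in es.
have es' : eval_at s x = (c.@[x 0])^-1 * b' *: p.
  by rewrite -scalerA -es scalerA mulVf // scale1r.
have ev := eval_veronese_form n s x; rewrite es' veroneseZ in ev.
have wE k : (w 0 k).@[x 0] = b * veronese n p 0 k.
  by move/rowP/(_ k): ew; rewrite [LHS]mxE [RHS]mxE.
have vE k : (veronese_form n s 0 k).@[x 0] = (c.@[x 0]^-1 * b') ^+ n * veronese n p 0 k.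
  by move/rowP/(_ k): ev; rewrite [LHS]mxE [RHS]mxE.
by rewrite mevalB !mevalM !wE !vE; ring.
Qed.

Lemma scroll_coordinates h l n (A : 'M[K]_(h.+1, n)) (B : 'M[K]_(l.+1, n)) :
  scroll_data A B -> (h.+1 + l.+1 = n)%N ->
  exists DA : 'M[K]_(n, h.+1), exists DB : 'M[K]_(n, l.+1),
  [/\ A *m DB = 0, B *m DB = 1%:M, A *m DA = 1%:M, B *m DA = 0
    & DA *m A + DB *m B = 1%:M].
Proof.
case=> _ _ _ full en.
have fullC : row_full (col_mx A B) by rewrite /row_full -(addsmxE A B).
have freeC : row_free (col_mx A B) by rewrite /row_free (eqP fullC) en.
have [D DC] := row_fullP fullC.
have CD : col_mx A B *m D = 1%:M.
  by apply: (row_free_inj freeC); rewrite /= -mulmxA DC mulmx1 mul1mx.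
exists (lsubmx D), (rsubmx D).
move: CD DC; rewrite -{1 2}[D]hsubmxK mul_col_row mul_row_col scalar_mx_block.
by case/eq_block_mx.
Qed.

(** Every entry of the Veronese form but the first has the second entry of s as a
factor; for n = 0 the first entry is the only one. *)
Lemma veronese_tail n (s : 'rV[{mpoly K[2]}]_2) (c : 'cV[K]_n.+1) :
  c 0 0 = 0 ->
  exists r, (veronese_form n s *m const_form c) 0 0 = s 0 1 * r /\ (n = 0%N -> r = 0).
Proof.
move=> c0; exists (\sum_(i < n)
  (s 0 0 ^+ (n - i.+1) * s 0 1 ^+ i) * const_form c (lift ord0 i) 0).
split=> [|n0]; last by subst n; rewrite big_ord0.
rewrite mxE big_ord_recl mulr_sumr.
have -> : const_form c ord0 0 = 0.
  by rewrite mxE (_ : ord0 = 0) ?c0 // ?mpolyC0; apply: val_inj.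
rewrite mulr0 add0r; apply: eq_bigr => i _.
by rewrite [X in X * _ = _]mxE /= exprS; ring.
Qed.

Lemma mul_veronese_delta n m (A : 'M[K]_(n.+1, m)) :
  veronese n (point 1 0) *m A = row 0 A.
Proof.
rewrite rowE; congr (_ *m _); apply/rowP => i; rewrite !mxE /= expr1n mul1r expr0n.
by rewrite -val_eqE.
Qed.

Lemma on_fiber h l n (A : 'M[K]_(h.+1, n)) (B : 'M[K]_(l.+1, n)) p y :
  (y <= fiber A B p)%MS ->
  exists a, exists b, y = a *: (veronese h p *m A) + b *: (veronese l p *m B).
Proof.
case/submxP => c ->; rewrite -[c]hsubmxK mul_row_col.
exists (lsubmx c 0 0), (rsubmx c 0 0).
by rewrite {1}[lsubmx c]mx11_scalar {1}[rsubmx c]mx11_scalar !mul_scalar_mx.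
Qed.

Section Curve.
Variables (h l n d : nat) (A : 'M[K]_(h.+1, n)) (B : 'M[K]_(l.+1, n)).
Variable g : 'rV[{mpoly K[2]}]_n.
Hypotheses (l_gt0 : (0 < l)%N) (d_gt0 : (0 < d)%N) (dim_n : (h.+1 + l.+1 = n)%N).
Hypotheses (scrollAB : scroll_data A B) (gM : morphism_of_degree d g).

(** The projection of the scroll to the parameter line restricts to a map given
on the curve by the ratio of two consecutive coordinates; s is this map in
lowest terms, and m is the intersection number with a fiber. *)
Lemma scroll_curve_factorization :
  (forall x, x != 0 -> on_scroll A B (eval_at g x)) ->
  exists m, exists s : 'rV[{mpoly K[2]}]_2, exists al, exists be,
  [/\ morphism_of_degree m s, be \is (d - m * l).-homog &
      g = al *: (veronese_form h s *m const_form A)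
        + be *: (veronese_form l s *m const_form B)].
Proof.
move=> onS; have [gH gP] := gM.
have [DA [DB [ADB BDB ADA BDA DAB]]] := scroll_coordinates scrollAB dim_n.
pose a := g *m const_form DA; pose b := g *m const_form DB.
have aH : homog_row d a := homog_row_const DA gH.
have bH : homog_row d b := homog_row_const DB gH.
have gE : g = a *m const_form A + b *m const_form B.
  rewrite /a /b -!mulmxA -mulmxDr -!const_formM -map_mxD DAB.
  by rewrite map_scalar_mx /= mpolyC1 mulmx1.
have pt x : x != 0 -> exists p, (exists u, eval_at a x = u *: veronese h p) /\
    (exists u, eval_at b x = u *: veronese l p).
  move=> x0; have [p p0 /on_fiber[u [v e]]] := onS x x0.
  exists p; split; [exists u|exists v]; rewrite eval_const_mul e mulmxDl;
    rewrite -!scalemxAl -!mulmxA ?ADA ?BDA ?ADB ?BDB mulmx1 mulmx0 scaler0.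
    by rewrite addr0.
  by rewrite add0r.
have g0 : g != 0.
  have [j gj] := nonzero_entry gP; apply: contraNneq gj => ->.
  by rewrite mxE.
have [s0 [s0H s00 s0P]] : exists s : 'rV[{mpoly K[2]}]_2,
    [/\ homog_row d s, s != 0 & forall x p,
      (exists u, eval_at a x = u *: veronese h p) ->
      (exists u, eval_at b x = u *: veronese l p) -> exists c, eval_at s x = c *: p].
  have [b0|b0] := eqVneq b 0; last first.
    have [s [sH sn sP]] := consecutive_entries l_gt0 bH b0.
    by exists s; split=> // x p _ [c /sP].
  have ga : g = a *m const_form A by rewrite gE b0 mul0mx addr0.
  have a0 : a != 0 by apply: contraNneq g0 => a0; rewrite ga a0 mul0mx.
  have h_gt0 : (0 < h)%N.
    (* If h = 0, the curve would be the vertex, but a has a zero. *)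
    rewrite lt0n; apply/eqP => h0.
    have [x x0 ax] : exists2 x : 'rV[K]_2, x != 0 & (a 0 0).@[x 0] = 0.
      by apply: (@form_has_zero _ d.-1); rewrite prednK.
    case/eqP: (gP x x0); rewrite ga eval_const_mul (_ : eval_at a x = 0) ?mul0mx //.
    apply/eval_eq0P => j; rewrite -[RHS]ax; congr (a 0 _).@[_]; apply: val_inj.
    by case: j => [[|j]] //=; rewrite h0.
  have [s [sH sn sP]] := consecutive_entries h_gt0 aH a0.
  by exists s; split=> // x p [c /sP].
have [c [s [m [e [es cH c0 sM]]]]] := primitive_part s0H s00.
have [|al alH ea] := parallel_multiple (veronese_form_morphism h sM) aH.
  apply: (veronese_parallel aH sM cH c0) => x x0.
  have [p [pa pb]] := pt x x0; exists p; split=> //.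
  by rewrite -es; apply: s0P.
have [|be beH eb] := parallel_multiple (veronese_form_morphism l sM) bH.
  apply: (veronese_parallel bH sM cH c0) => x x0.
  have [p [pa pb]] := pt x x0; exists p; split=> //.
  by rewrite -es; apply: s0P.
by exists m, s, al, be; split=> //; rewrite gE ea eb -!scalemxAl.
Qed.

(** Over the parameter (1, 0), all the linear forms that vanish on the fiber
restrict to multiples of the second entry of s, of degree m. On a cone the
coordinate of the vertex drops out, and they are even multiples of this entry
times be, while be is the common divisor removed with the vertex. Either way
the unisecant condition leaves at most one for m. *)
Lemma unisecant_degree m (s : 'rV[{mpoly K[2]}]_2) al be :
  unisecant A B g -> morphism_of_degree m s -> be \is (d - m * l).-homog ->
  g = al *: (veronese_form h s *m const_form A)
    + be *: (veronese_form l s *m const_form B) -> (m <= 1)%N.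
Proof.
move=> unis sM beH gE; have [gH gP] := gM.
have [DA [DB [ADB BDB _ _ _]]] := scroll_coordinates scrollAB dim_n.
have p0 : point 1 0 != 0 :> 'rV[K]_2 by rewrite point_neq0 oner_neq0.
have [k [[qv [qv0 qvH qvdiv _]] [q [q0 qH _ qmax]]]] := unis _ p0.
have glam (lam : 'cV[K]_n) : (g *m const_form lam) 0 0 =
    al * (veronese_form h s *m const_form (A *m lam)) 0 0
  + be * (veronese_form l s *m const_form (B *m lam)) 0 0.
  rewrite gE mulmxDl -!scalemxAl -!mulmxA -!const_formM.
  by rewrite [LHS]mxE; congr (_ + _); rewrite [LHS]mxE.
have tails (lam : 'cV[K]_n) : fiber A B (point 1 0) *m lam = 0 ->
    (A *m lam) 0 0 = 0 /\ (B *m lam) 0 0 = 0.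
  rewrite mul_col_mx !mul_veronese_delta -col_mx0 => /eq_col_mx[eA eB].
  split; [move: eA|move: eB]; rewrite -row_mul => /rowP/(_ 0).
    by rewrite !mxE.
  by rewrite !mxE.
have [h0|h_gt0] := posnP h.
  have /qmax[r er] : forall lam : 'cV[K]_n, fiber A B (point 1 0) *m lam = 0 ->
      divides (s 0 1 * be) ((g *m const_form lam) 0 0).
    move=> lam /tails[A0 B0]; rewrite glam.
    have [ra [-> ra0]] := veronese_tail s A0; have [rb [-> _]] := veronese_tail s B0.
    by exists rb; rewrite ra0 //; ring.
  have sb0 : s 0 1 * be != 0 by apply: contraNneq q0 => e0; rewrite er e0 mul0r.
  have r0 : r != 0 by apply: contraNneq q0 => e0; rewrite er e0 mulr0.
  have be0 : be != 0 by apply: contraNneq sb0 => ->; rewrite mulr0.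
  have le1 : (m + (d - m * l) <= k.+1)%N.
    by apply: (homog_degM (dhomogM (sM.1 1) beH) sb0 r0); rewrite -er.
  have [j|r' r'H er'] := euclid_lemma (veronese_form_morphism l sM).2 qvH qv0 beH.
    have ej : A *m (DB *m delta_mx j 0) = 0 :> 'cV_h.+1.
      by rewrite mulmxA ADB mul0mx.
    have vA : vertex A = A by rewrite /vertex; case: eqP => // /(_ h0).
    have := qvdiv (DB *m delta_mx j 0); rewrite vA => /(_ ej).
    rewrite glam ej mulmxA BDB mul1mx /const_form map_mx0 mulmx0 map_delta_mx -colE.
    by rewrite [X in al * X]mxE mulr0 add0r [X in be * X]mxE.
  have r'0 : r' != 0 by apply: contraNneq be0 => e0; rewrite er' e0 mulr0.
  rewrite er' in beH.
  have le2 := homog_degM qvH qv0 r'0 beH.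
  rewrite -ltnS in le2.
  by have := leq_trans le1 le2; rewrite -[in X in (_ <= X)%N]add1n leq_add2r.
have k0 : k = 0%N.
  case: k qvH {qH q0 qmax} => [//|k] qvH; have [x x0 qx] := form_has_zero qvH.
  case/eqP: (gP x x0); apply/eval_eq0P => j.
  have vA : vertex A = 0 by rewrite /vertex; case: eqP => // e0; rewrite e0 in h_gt0.
  have := qvdiv (delta_mx j 0); rewrite vA mul0mx => /(_ erefl)[r].
  rewrite /const_form map_delta_mx -colE [LHS]mxE => ->.
  by rewrite mevalM qx mul0r.
have /qmax[r er] : forall lam : 'cV[K]_n, fiber A B (point 1 0) *m lam = 0 ->
    divides (s 0 1) ((g *m const_form lam) 0 0).
  move=> lam /tails[A0 B0]; rewrite glam.
  have [ra [-> _]] := veronese_tail s A0; have [rb [-> _]] := veronese_tail s B0.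
  by exists (al * ra + be * rb); ring.
have s1 : s 0 1 != 0 by apply: contraNneq q0 => e0; rewrite er e0 mul0r.
have r0 : r != 0 by apply: contraNneq q0 => e0; rewrite er e0 mulr0.
by rewrite er k0 in qH; apply: homog_degM (sM.1 1) s1 r0 qH.
Qed.
End Curve.
End Scroll.

(** * The splitting type of the projection *)

Unset Implicit Arguments.

(* D is the image of g, S is the scroll of A and B, P_1, ..., P_(k-1) are the
   rows of P, T is the matrix of a linear projection with center their span,
   and C is the image of f, the composite of g with this projection. *)
Theorem proposition2p1 (K : closedFieldType) (charK0 : [pchar K] =i pred0)
    (k d : nat) (k_gt0 : (0 < k)%N) (le_2k_d : (2 * k <= d)%N)
    (g : 'rV[{mpoly K[2]}]_k.+2) (smoothD : smooth_rational_curve d g)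
    (h : nat) (le_h : (h <= k - h)%N)
    (A : 'M[K]_(h.+1, k.+2)) (B : 'M[K]_((k - h).+1, k.+2))
    (scrollS : scroll_data A B)
    (D_sub_S : forall x : 'rV[K]_2, x != 0 -> on_scroll A B (eval_at g x))
    (unisecD : unisecant A B g)
    (P : 'M[K]_(k.-1, k.+2)) (P_indep : row_free P)
    (P_notin_S : forall i, ~ on_scroll A B (row i P))
    (T : 'M[K]_(k.+2, 3)) (centerT : (kermx T == P)%MS)
    (f : 'rV[{mpoly K[2]}]_3) (def_f : f = g *m const_form T)
    (morphf : morphism_of_degree d f) (injf : generically_injective f) :
  exists k' : nat, (k' <= k)%N /\ splitting_type d f k'.
Proof.
have [gM _ _] := smoothD.
have l_gt0 : (0 < k - h)%N by lia.
have d_gt1 : (1 < d)%N by lia.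
have ek : (h.+1 + (k - h).+1 = k.+2)%N by lia.
have [m [s [al [be [[sH sP] beH gE]]]]] :=
  scroll_curve_factorization l_gt0 (ltnW d_gt1) ek scrollS gM D_sub_S.
have m1 := unisecant_degree ek scrollS gM unisecD (conj sH sP) beH gE.
(* The images u and w of the two ends of a fiber span the moving line. *)
pose u := veronese_form h s *m const_form (A *m T).
pose w := veronese_form (k - h) s *m const_form (B *m T).
have uH : homog_row (m * h) u.
  by apply: homog_row_const; apply: (veronese_form_morphism h (conj sH sP)).1.
have wH : homog_row (m * (k - h)) w.
  by apply: homog_row_const; apply: (veronese_form_morphism (k - h) (conj sH sP)).1.
have fE : f = al *: u + be *: w.
  by rewrite def_f gE mulmxDl -!scalemxAl /u /w !const_formM !mulmxA.
have crossH := homog_cross uH wH.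
have degE : (m * h + m * (k - h) <= k)%N.
  by rewrite -mulnDr subnKC ?(leq_trans le_h) ?leq_subr //
    -[X in (_ <= X)%N]mul1n leq_mul2r m1 orbT.
have cross_syz : cross u w *m f^T = 0.
  rewrite fE linearD !linearZ /= mulmxDr -!scalemxAr cross_dotl cross_dotr.
  by rewrite !scaler0 addr0.
(* If u and w were parallel, f would be parallel to both; but f has no common
   zeros and its degree exceeds theirs. *)
have cross_neq0 : cross u w != 0.
  apply/eqP => /cross_eq0 par.
  have fi i : f 0 i = al * u 0 i + be * w 0 i by rewrite fE !mxE.
  have u0 : u = 0.
    apply: (parallel_small morphf uH) => [i j|]; last by move: degE; lia.
    by rewrite !fi; ring: (par i j).
  have w0 : w = 0.
    apply: (parallel_small morphf wH) => [i j|]; last by move: degE; lia.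
    by rewrite !fi; ring: (par i j).
  have [j] := nonzero_entry morphf.2.
  by rewrite fi u0 w0 !mxE !mulr0 addr0 eqxx.
have no_const := not_in_line charK0 d_gt1 morphf injf.
have [|a le_a split_a] :=
  syzygy_resolution morphf no_const crossH cross_neq0 cross_syz.
  by move: degE le_2k_d; lia.
by exists a; split=> //; apply: leq_trans degE.
Qed.
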